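(* Let $q$ be an odd prime, let $\{a_{1}, a_{2}, \ldots, a_{l}\}\subseteq\mathbb{Z}\setminus\{-1,1\}$ be a finite set of $q$-free integers, and let $(c_{j})_{j=1}^{l}\in\big(\mathbb{F}_{q}\setminus\{0\}\big)^{l}$. Then the polynomial \[(x^{q} - a_{1}) (x^{q} - a_{2}) \cdots (x^{q} - a_{l})\] is intersective if and only if the polynomial \[\big(x^{q} - \mathrm{rad}_{q}(a_{1}^{c_{1}})\big) \big(x^{q} - \mathrm{rad}_{q}(a_{2}^{c_{2}})\big) \cdots \big(x^{q} - \mathrm{rad}_{q}(a_{l}^{c_{l}})\big)\] is intersective.
   Context: $\mathbb{F}_q$ is the finite field with $q$ elements; in the exponent, an element $c\in\mathbb{F}_q\setminus\{0\}$ is read as its representative in $\{1,\ldots,q-1\}$. An integer $a$ is called $q$-free if $p^{q}\nmid a$ for every prime $p$ (in particular $a\neq 0$). For an integer $b$, not a perfect $q^{th}$ power, with signed prime factorization $b=\pm\prod_{i=1}^{m}p_i^{e_i}$, its $q$-free part is $\mathrm{rad}_q(b):=\pm\prod_{i=1}^{m}p_i^{\,e_i \bmod q}$, with the same sign as $b$ and with $e_i \bmod q\in\{0,\ldots,q-1\}$. Intersective: for $T\subseteq\mathbb{Z}$ the upper density is $\bar d(T)=\limsup_{N\to\infty}\frac{|T\cap\{-N,\ldots,N\}|}{2N+1}$. A set $S\subseteq\mathbb{Z}$ is an intersective set if for every $T\subseteq\mathbb{Z}$ with $\bar d(T)>0$ one has $S\cap(T-T)\not\subseteq\{0\}$, where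 $T-T=\{t_1-t_2: t_1,t_2\in T\}$. A polynomial $f(x)\in\mathbb{Z}[x]$ is intersective if $\{f(x):x\in\mathbb{Z}\}$ is an intersective set. By a known theorem of Kamae and Mendès-France (which the paper uses as the working meaning of the term), $f$ is intersective if and only if $f(x)\equiv 0 \pmod m$ is solvable in integers for every positive integer $m$. *)

(* Defs.v *)
From HB Require Import structures.
From mathcomp Require Import all_boot all_order all_algebra.
From mathcomp Require Import finmap.
From mathcomp Require Import all_classical all_reals all_analysis.

Set Implicit Arguments.
Unset Strict Implicit.
Unset Printing Implicit Defensive.

Import Order.TTheory GRing.Theory Num.Theory.

Local Open Scope classical_set_scope.
Local Open Scope ring_scope.

(* The counted set is finite, so [fset_set] does not take its default value;
   the limsup is taken in [\bar R] so that it needs no boundedness side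
   condition (its value lies in [0, 1]). *)
Definition upper_density (R : realType) (T : set int) : \bar R :=
  limn_esup (fun N : nat =>
    ((#|` fset_set (T `&` [set k : int | - N%:Z <= k <= N%:Z])|)%:R
       / (2 * N + 1)%N%:R : R)%:E).

Definition difference_set (T : set int) : set int :=
  [set t1 - t2 | t1 in T & t2 in T].

Definition intersective_set (R : realType) (S : set int) : Prop :=
  forall T : set int, (0 < upper_density R T)%E ->
    ~ (S `&` difference_set T `<=` [set 0]).

Definition intersective (R : realType) (f : {poly int}) : Prop :=
  intersective_set R (range (fun x : int => f.[x])).

Definition qfree (q : nat) (a : int) : Prop :=
  forall p : nat, prime p -> ~~ (p%:Z ^+ q %| a)%Z.

(* Meaningful for [b] not a perfect [q]-th power (so [b != 0]). *)
Definition radq (q : nat) (b : int) : int :=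
  sgz b * \prod_(p <- primes `|b|%N) p%:Z ^+ (logn p `|b|%N %% q)%N.

(* Main.v *)
From HB Require Import structures.
Require Import Defs.
From mathcomp Require Import all_boot all_order all_algebra finmap.
From mathcomp Require Import all_classical all_reals all_analysis.
From mathcomp Require Import ring lra zify.

Set Implicit Arguments.
Unset Strict Implicit.
Unset Printing Implicit Defensive.

Import Order.TTheory GRing.Theory Num.Theory numFieldNormedType.Exports.
Local Open Scope classical_set_scope.
Local Open Scope ring_scope.

(* A nonzero integer polynomial is intersective iff it has a root modulo every
   m > 0 (Kamae and Mendes France), and root existence modulo all m depends only
   on which of the x^q - a_j has roots modulo all powers of each prime p.  The
   latter says that a_j is a q-th power in Z_p; it is insensitive to replacing
   a_j by a_j^c with c prime to q and to multiplication by q-th powers.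

   Kamae-Mendes France is proved with no spectral theory.  An ultrafilter along
   which T has positive density turns averages over [-N, N] into a
   shift-invariant mean, hence a semi-inner product on bounded functions with
   an isometric shift U.  If C_k is the convex hull of the orbit of 1_T under
   U^k, choose k for which the minimal norm on C_k is almost the largest
   possible, let psi be a near-minimizer in C_k and w = 1_T - psi.  By the
   parallelogram law psi is almost U^k-invariant; by the choice of k, w is almost
   orthogonal to all U^a-fixed vectors, so by van der Corput's inequality its
   averages along any nonconstant polynomial are small.  Along a progression on
   which f is nonzero and divisible by k, the averages of
   <U^f(n) 1_T, 1_T> are therefore close to <psi, 1_T>, which is bounded below
   by about the square of the density of T. *)

(** * Roots modulo all integers *)

Definition locally_solvable (f : {poly int}) : Prop :=
  forall m : nat, (0 < m)%N -> exists x : int, (m%:Z %| f.[x])%Z.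

Lemma PoszX (p k : nat) : (p ^ k)%N%:Z = p%:Z ^+ k.
Proof. by rewrite -natz natrX natz. Qed.

(* [b] is a [q]-th power in the [p]-adic integers. *)
Definition padic_power (p q : nat) (b : int) : Prop :=
  forall k : nat, exists x : int, (p%:Z ^+ k %| x ^+ q - b)%Z.

Lemma dvdz_horner_sub (f : {poly int}) (x y : int) : (x - y %| f.[x] - f.[y])%Z.
Proof.
have /factor_theorem[g fE] : root (f - f.[y]%:P) y.
  by rewrite rootE !hornerE subrr.
have := congr1 (fun h => h.[x]) fE; rewrite !hornerE => ->.
exact: dvdz_mull.
Qed.

(** Induction on [m]: the full power of the prime [pdiv m] is split off and the two roots are glued
    by the Chinese remainder theorem, since [f.[x]] modulo [d] depends only on [x] modulo [d]. *)
Lemma locally_solvableP (f : {poly int}) :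
  locally_solvable f <->
  forall p k : nat, prime p -> exists x : int, (p%:Z ^+ k %| f.[x])%Z.
Proof.
split=> [fS p k p_prime | fS m].
  by have [|x] := fS (p ^ k)%N; [rewrite expn_gt0 prime_gt0 | rewrite PoszX; exists x].
have [n] := ubnP m; elim: n m => // n IH m; rewrite ltnS => mn m_gt0.
have [->|m_neq1] := eqVneq m 1%N; first by exists 0; rewrite dvd1z.
have m_gt1 : (1 < m)%N by case: (m) m_gt0 m_neq1 => [|[]].
have p_prime := pdiv_prime m_gt1.
have [m' cop mE] := pfactor_coprime p_prime m_gt0.
have m'_gt0 : (0 < m')%N by move: m_gt0; rewrite {1}mE; case: (m').
have log_gt0 : (0 < logn (pdiv m) m)%N by rewrite logn_gt0 mem_primes p_prime m_gt0 pdiv_dvd.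
have m'_lt : (m' < n)%N.
  apply: leq_trans mn; rewrite [X in (_ < X)%N]mE ltn_Pmulr //.
  by rewrite -(exp1n (logn (pdiv m) m)) ltn_exp2r // prime_gt1.
have [x1 x1P] := fS (pdiv m) (logn (pdiv m) m) p_prime.
have [x2 x2P] := IH m' m'_lt m'_gt0.
have copz : coprimez ((pdiv m)%:Z ^+ logn (pdiv m) m) m'.
  by apply: coprimezXl; rewrite coprimezE.
set x := zchinese ((pdiv m)%:Z ^+ logn (pdiv m) m) m' x1 x2.
exists x; rewrite {1}mE PoszM mulrC PoszX Gauss_dvdz //.
have transfer (d y : int) : (d %| x - y)%Z -> (d %| f.[y])%Z -> (d %| f.[x])%Z.
  move=> dxy dy; rewrite -(subrK f.[y] f.[x]) rpredD //.
  exact: dvdz_trans dxy (dvdz_horner_sub _ _ _).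
apply/andP; split.
  by apply: transfer x1P; rewrite -eqz_mod_dvd; apply/eqP/zchinese_modl.
by apply: transfer x2P; rewrite -eqz_mod_dvd; apply/eqP/zchinese_modr.
Qed.

(** Write d = p^s d' with d' prime to p. If p^(sq+k) divides x^q - b d^q, then p^s divides x;
    cancelling p^(sq) and inverting d' modulo p^k gives a q-th root of b modulo p^k. *)
Lemma padic_power_mul (p q : nat) (b d : int) :
  prime p -> (0 < q)%N -> d != 0 ->
  padic_power p q (b * d ^+ q) <-> padic_power p q b.
Proof.
move=> p_prime q_gt0 d_neq0; split=> bP k; last first.
  by have [x xP] := bP k; exists (x * d); rewrite exprMn -mulrBl dvdz_mulr.
have [|m cop dE] := pfactor_coprime p_prime (n := `|d|%N); first by rewrite absz_gt0.
set s := logn p `|d| in dE.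
pose d' := sgz d * m%:Z.
have dE' : d = p%:Z ^+ s * d'.
  by rewrite /d' [LHS]intEsg dE PoszM PoszX; ring.
have cop' : coprimez (p%:Z ^+ k) d'.
  rewrite coprimezXl // coprimezE abszM coprimeMr cop andbT.
  by rewrite -sgrz absz_sg d_neq0 coprimen1.
clearbody d'.
have [x xP] := bP (s * q + k)%N.
have pn0 : p%:Z != 0 by rewrite eqz_nat -lt0n prime_gt0.
have : (p%:Z ^+ s %| x)%Z.
  rewrite -(dvdz_pexp2r _ _ q_gt0) -exprM -(subrK (b * d ^+ q) (x ^+ q)).
  rewrite rpredD //; first by apply: dvdz_trans xP; rewrite dvdz_exp2l // leq_addr.
  by rewrite dvdz_mull // exprM dvdz_exp2r // dE' dvdz_mulr.
case/dvdzP=> y xE; move: xP; rewrite dE' xE !exprMn exprD exprM.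
have -> : y ^+ q * (p%:Z ^+ s) ^+ q - b * ((p%:Z ^+ s) ^+ q * d' ^+ q)
  = (p%:Z ^+ s) ^+ q * (y ^+ q - b * d' ^+ q) by ring.
rewrite dvdz_mul2l ?expf_neq0 // => yP.
have /coprimezP[[u v] /= uvE] := cop'.
exists (v * y).
have vE : (p%:Z ^+ k %| (v * d') ^+ q - 1)%Z.
  have -> : v * d' = 1 - u * p%:Z ^+ k by rewrite -uvE; ring.
  have := dvdz_horner_sub 'X^q (1 - u * p%:Z ^+ k) 1.
  rewrite !hornerE expr1n; apply: dvdz_trans.
  by rewrite addrAC subrr add0r rpredN dvdz_mull.
have -> : (v * y) ^+ q - b = v ^+ q * (y ^+ q - b * d' ^+ q) + b * ((v * d') ^+ q - 1).
  by rewrite !exprMn; ring.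
by rewrite rpredD // dvdz_mull.
Qed.

(** Bezout gives u c = v q + 1, so the u-th power of a^c is a times the q-th power of a^v, which
    [padic_power_mul] removes. *)
Lemma padic_power_exp (p q c : nat) (a : int) :
  prime p -> (0 < q)%N -> (0 < c)%N -> coprime q c -> a != 0 ->
  padic_power p q (a ^+ c) <-> padic_power p q a.
Proof.
move=> p_prime q_gt0 c_gt0 cop a_neq0.
have powP (b : int) (e : nat) : padic_power p q b -> padic_power p q (b ^+ e).
  move=> bP k; have [x xP] := bP k; exists (x ^+ e).
  apply: dvdz_trans xP _; rewrite exprAC.
  by have := dvdz_horner_sub 'X^e (x ^+ q) b; rewrite !hornerE.
split=> [acP|]; last exact: powP.
have [e _ /dvdnP[t]] := Bezoutl c q_gt0.
rewrite (eqP cop) => etE.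
have [u v uvE _] := egcdnP q c_gt0.
rewrite gcdnC (eqP cop) in uvE.
have := powP _ u acP.
rewrite -exprM mulnC uvE exprD expr1 mulrC exprM padic_power_mul //.
exact: expf_neq0.
Qed.

(** Each exponent is divided by q with remainder: [d] collects the quotients, [radq] keeps the
    remainders and the sign. *)
Lemma radq_decomposition (q : nat) (b : int) :
  b != 0 -> exists2 d : int, d != 0 & b = radq q b * d ^+ q.
Proof.
move=> b_neq0.
exists (\prod_(r <- primes `|b|%N) r%:Z ^+ (logn r `|b|%N %/ q)%N).
  rewrite prodf_seq_neq0; apply/allP => r; rewrite mem_primes => /andP[r_prime _].
  by rewrite implyTb expf_neq0 // eqz_nat -lt0n prime_gt0.
rewrite {1}[b]intEsg /radq -mulrA; congr (_ * _).
rewrite {1}(@prod_prime_decomp `|b|%N) ?absz_gt0 // prime_decompE big_map /=.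
rewrite -natz natr_prod -prodrXl -big_split /=; apply: eq_bigr => r _.
by rewrite natrX natz -exprM -exprD addnC -divn_eq.
Qed.

Lemma logn_prod (I : Type) (r : seq I) (p : nat) (F : I -> nat) :
  (forall i, 0 < F i)%N ->
  logn p (\prod_(i <- r) F i) = (\sum_(i <- r) logn p (F i))%N.
Proof.
move=> F_gt0; elim: r => [|i r IH]; first by rewrite !big_nil logn1.
by rewrite !big_cons lognM ?IH // prodn_gt0.
Qed.

(* Pigeonhole: if no factor had roots modulo all powers of [p], the valuations
   of all factors, hence of the product, would be bounded. *)
Lemma padic_power_prod (p q l : nat) (a : 'I_l -> int) :
  prime p ->
  (forall k : nat, exists x : int,
     (p%:Z ^+ k %| (\prod_(j < l) ('X^q - (a j)%:P)).[x])%Z) <->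
  exists j : 'I_l, padic_power p q (a j).
Proof.
move=> p_prime.
have hornerE' x : (\prod_(j < l) ('X^q - (a j)%:P)).[x] = \prod_(j < l) (x ^+ q - a j).
  by rewrite horner_prod; apply: eq_bigr => j _; rewrite !hornerE.
split=> [fP | [j jP] k]; last first.
  have [x xP] := jP k; exists x; rewrite hornerE' (bigD1 j) //=.
  exact: dvdz_mulr.
apply: contrapT => /forallNP aP.
have {}aP j : {k : nat | forall x : int, ~~ (p%:Z ^+ k %| x ^+ q - a j)%Z}.
  have /existsNP/cid[k kP] := aP j; exists k => x; apply/negP => xP; apply: kP.
  by exists x.
(* The successor matters for l = 0, where the sum of exponents vanishes and so does the valuation of
   the empty product. *)
have [x] := fP (\sum_(j < l) sval (aP j)).+1.
rewrite hornerE' dvdzE abszX absz_nat.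
have gt0 j : (0 < `|x ^+ q - a j|)%N.
  rewrite absz_gt0; apply/eqP => x0; have := svalP (aP j) x.
  by rewrite x0 dvdz0.
have -> : `|(\prod_(j < l) (x ^+ q - a j))%R|%N = (\prod_(j < l) `|(x ^+ q - a j)%R|)%N.
  by apply: (big_morph absz) => //; exact: abszM.
rewrite pfactor_dvdn ?prodn_gt0 // logn_prod // ltnNge => /negP; apply.
apply: leq_sum => j _; have := svalP (aP j) x.
rewrite dvdzE abszX absz_nat pfactor_dvdn // -ltnNge; exact: ltnW.
Qed.

(** For each prime p, the same indices j give q-th powers in the p-adic integers on both sides. *)
Lemma locally_solvable_radq (q l : nat) (a : 'I_l -> int) (c : 'I_l -> nat) :
  (0 < q)%N -> (forall j, a j != 0) -> (forall j, 0 < c j)%N ->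
  (forall j, coprime q (c j)) ->
  locally_solvable (\prod_(j < l) ('X^q - (a j)%:P)) <->
  locally_solvable (\prod_(j < l) ('X^q - (radq q (a j ^+ c j))%:P)).
Proof.
move=> q_gt0 a_neq0 c_gt0 cop; rewrite !locally_solvableP.
have radP p j : prime p ->
    padic_power p q (a j) <-> padic_power p q (radq q (a j ^+ c j)).
  move=> p_prime.
  have [d d_neq0 acE] := radq_decomposition q (expf_neq0 (c j) (a_neq0 j)).
  rewrite -(padic_power_mul (radq _ _) p_prime q_gt0 d_neq0) -acE.
  by rewrite padic_power_exp.
split=> H p k p_prime; move: k; apply/padic_power_prod => //.
  have [|j jP] := (padic_power_prod q a p_prime).1; first by move=> k; exact: H.
  by exists j; apply/radP.
have [|j jP] := (padic_power_prod q (fun j => radq q (a j ^+ c j)) p_prime).1.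
  by move=> k; exact: H.
by exists j; apply/radP.
Qed.

(** * Isometric actions of the integers on semi-inner product spaces *)

Lemma sumr_const_ord (R : pzSemiRingType) (N : nat) (t : R) :
  \sum_(n < N) t = N%:R * t.
Proof. by rewrite sumr_const card_ord mulr_natl. Qed.

(* Differences are taken between any two distinct shifts, rather than between a
   shift and [s] itself, so that no reindexing is needed in the van der Corput
   inequality. *)
Fixpoint difference_degree (d : nat) (s : nat -> int) : Prop :=
  match d with
  | 0 => exists a b : int, a != 0 /\ forall n : nat, s n = a * n%:Z + b
  | d'.+1 => forall i j : nat, i != j ->
      difference_degree d' (fun n => s (n + i)%N - s (n + j)%N)
  end.

Section SemiInnerProduct.
Context (R : realType) (V : lmodType R) (B : V -> V -> R).
Hypothesis formDl : forall u v w, B (u + v) w = B u w + B v w.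
Hypothesis formZl : forall (t : R) u w, B (t *: u) w = t * B u w.
Hypothesis formC : forall u v, B u v = B v u.
Hypothesis form_ge0 : forall u, 0 <= B u u.

Definition seminorm (v : V) : R := Num.sqrt (B v v).
Local Notation "''n' v" := (seminorm v) (at level 10, v at level 8).

Lemma formDr u v w : B w (u + v) = B w u + B w v.
Proof. by rewrite formC formDl !(formC w). Qed.

Lemma formZr (t : R) u w : B w (t *: u) = t * B w u.
Proof. by rewrite formC formZl formC. Qed.

Lemma formNl u w : B (- u) w = - B u w.
Proof. by rewrite -scaleN1r formZl mulN1r. Qed.

Lemma formNr u w : B w (- u) = - B w u.
Proof. by rewrite formC formNl formC. Qed.

Lemma form0l w : B 0 w = 0.
Proof. by rewrite -(scale0r w) formZl mul0r. Qed.

Lemma form_suml (I : Type) (r : seq I) (F : I -> V) w :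
  B (\sum_(i <- r) F i) w = \sum_(i <- r) B (F i) w.
Proof. by apply: (big_morph (B ^~ w)) => [u v|]; [exact: formDl | exact: form0l]. Qed.

Lemma form_sumr (I : Type) (r : seq I) (F : I -> V) w :
  B w (\sum_(i <- r) F i) = \sum_(i <- r) B w (F i).
Proof. by rewrite formC form_suml; apply: eq_bigr => i _; rewrite formC. Qed.

Lemma seminorm_ge0 v : 0 <= 'n v.
Proof. exact: sqrtr_ge0. Qed.

Lemma sqr_seminorm v : 'n v ^+ 2 = B v v.
Proof. exact: sqr_sqrtr. Qed.

Lemma seminorm_le v (t : R) : 0 <= t -> B v v <= t ^+ 2 -> 'n v <= t.
Proof.
move=> t_ge0 Bt; rewrite -(ler_pXn2r (n := 2)) ?nnegrE ?seminorm_ge0 //.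
by rewrite sqr_seminorm.
Qed.

Lemma semi_inner_le u v : B u v <= 'n u * 'n v.
Proof.
have [Buv|Buv] := lerP (B u v) 0.
  by apply: le_trans Buv _; rewrite mulr_ge0 ?seminorm_ge0.
rewrite -(ler_pXn2r (n := 2)) ?nnegrE ?mulr_ge0 ?seminorm_ge0 ?(ltW Buv) //.
rewrite exprMn !sqr_seminorm.
have quad (t : R) : 0 <= B u u + 2 * t * B u v + t ^+ 2 * B v v.
  have := form_ge0 (u + t *: v); rewrite !(formDl, formDr, formZl, formZr) (formC v u).
  by congr (_ <= _); ring.
(* If [B v v = 0], the quadratic is affine in t and equals -1 at the chosen t; otherwise its minimum
   gives the claim. *)
have := form_ge0 v; rewrite le_eqVlt => /predU1P[Bv0|Bv_gt0].
  have := quad (- (B u u + 1) / (2 * B u v)); rewrite -Bv0 mulr0 addr0.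
  have -> : 2 * (- (B u u + 1) / (2 * B u v)) * B u v = - (B u u + 1).
    by field; rewrite gt_eqF.
  lra.
have := quad (- B u v / B v v).
have -> : B u u + 2 * (- B u v / B v v) * B u v + (- B u v / B v v) ^+ 2 * B v v
   = (B u u * B v v - B u v ^+ 2) / B v v by field; rewrite gt_eqF.
by rewrite pmulr_lge0 ?invr_gt0 // subr_ge0.
Qed.

Lemma seminormZ (t : R) v : 'n (t *: v) = `|t| * 'n v.
Proof.
rewrite /seminorm formZl formZr mulrA -expr2 sqrtrM ?sqr_ge0 //.
by rewrite sqrtr_sqr.
Qed.

Lemma seminormN v : 'n (- v) = 'n v.
Proof. by rewrite -scaleN1r seminormZ normrN1 mul1r. Qed.

Lemma seminormB u v : 'n (u - v) = 'n (v - u).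
Proof. by rewrite -seminormN opprB. Qed.

Lemma seminorm0 : 'n 0 = 0.
Proof. by rewrite -(scale0r 0) seminormZ normr0 mul0r. Qed.

Lemma seminormD u v : 'n (u + v) <= 'n u + 'n v.
Proof.
apply: seminorm_le; first by rewrite addr_ge0 ?seminorm_ge0.
rewrite !(formDl, formDr) (formC v u) -!sqr_seminorm.
have := semi_inner_le u v; lra.
Qed.

Lemma seminorm_sum (I : Type) (r : seq I) (F : I -> V) :
  'n (\sum_(i <- r) F i) <= \sum_(i <- r) 'n (F i).
Proof.
elim: r => [|i r IH]; first by rewrite !big_nil seminorm0.
by rewrite !big_cons (le_trans (seminormD _ _)) // lerD2l.
Qed.

Lemma semi_inner_abs_le u v : `|B u v| <= 'n u * 'n v.
Proof.
by rewrite ler_norml semi_inner_le lerNl -formNl -(seminormN u) semi_inner_le.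
Qed.

Lemma sqr_seminorm_sum (N : nat) (v : nat -> V) :
  B (\sum_(n < N) v n) (\sum_(n < N) v n) <= N%:R * \sum_(n < N) B (v n) (v n).
Proof.
rewrite form_suml.
have -> : \sum_(n < N) B (v n) (\sum_(n' < N) v n')
    = \sum_(n < N) \sum_(n' < N) B (v n) (v n').
  by apply: eq_bigr => n _; rewrite form_sumr.
have le2 (n n' : 'I_N) :
    B (v n) (v n') <= 2^-1 * B (v n) (v n) + 2^-1 * B (v n') (v n').
  by have := form_ge0 (v n - v n'); rewrite !(formDl, formDr, formNl, formNr) (formC (v n')); lra.
apply: le_trans (ler_sum _ (fun n _ => ler_sum _ (fun n' _ => le2 n n'))) _.
under eq_bigr do rewrite big_split /= sumr_const_ord.
rewrite big_split /= sumr_const_ord -!mulr_sumr.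
by rewrite le_eqVlt; apply/orP; left; apply/eqP; field.
Qed.

(** Each unit shift changes the sum only in its two end terms. *)
Lemma seminorm_shift_sum (u : nat -> V) (K : R) (i N : nat) :
  (forall n, 'n (u n) <= K) ->
  'n (\sum_(n < N) u n - \sum_(n < N) u (n + i)%N) <= 2 * i%:R * K.
Proof.
move=> uK; elim: i => [|i IH].
  under [X in _ - X]eq_bigr do rewrite addn0.
  by rewrite subrr seminorm0 mulr0 mul0r.
rewrite -(subrK (\sum_(n < N) u (n + i)%N) (\sum_(n < N) u n)) -addrA.
apply: le_trans (seminormD _ _) _.
have -> : 2 * i.+1%:R * K = 2 * i%:R * K + 2 * K by rewrite -natr1; ring.
apply: lerD => //; rewrite -sumrB.
have -> : \sum_(n < N) (u (n + i)%N - u (n + i.+1)%N) = u i - u (N + i)%N.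
  rewrite -(big_mkord xpredT (fun n => u (n + i)%N - u (n + i.+1)%N)) /=.
  rewrite (@telescope_sumr_eq _ 0 N (fun n => - u (n + i)%N)) //.
    by rewrite add0n opprK addrC.
  by move=> n _; rewrite opprK addnS addSn addrC.
by apply: le_trans (seminormD _ _) _; rewrite seminormN mulr_natl mulr2n lerD.
Qed.

(** Up to end terms, H times the sum of [u] is the sum of its blocks of H consecutive terms, and
    Cauchy-Schwarz over n bounds the latter by correlations. Assuming a bound [Y ^+ 2] keeps square
    roots out of the conclusion. *)
Lemma van_der_corput (u : nat -> V) (K Y : R) (H N : nat) :
  (forall n, 'n (u n) <= K) -> 0 <= Y ->
  N%:R * \sum_(i < H) \sum_(j < H) \sum_(n < N) B (u (n + i)%N) (u (n + j)%N)
    <= Y ^+ 2 ->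
  'n (\sum_(n < N) u n) * H%:R <= 2 * H%:R ^+ 2 * K + Y.
Proof.
move=> uK Y_ge0 corr.
have K_ge0 : 0 <= K by exact: le_trans (seminorm_ge0 _) (uK 0%N).
pose v n := \sum_(i < H) u (n + i)%N.
have vY : 'n (\sum_(n < N) v n) <= Y.
  apply: seminorm_le => //; apply: le_trans (sqr_seminorm_sum _ _) _.
  apply: le_trans corr; rewrite ler_wpM2l //.
  rewrite le_eqVlt; apply/orP; left; apply/eqP.
  under eq_bigr do rewrite form_suml.
  rewrite exchange_big /=; apply: eq_bigr => i _.
  by rewrite exchange_big /=; apply: eq_bigr => n _; rewrite form_sumr.
have -> : 'n (\sum_(n < N) u n) * H%:R = 'n (\sum_(i < H) \sum_(n < N) u n).
  by rewrite sumr_const card_ord -[X in _ = seminorm X]scaler_nat seminormZ normr_nat mulrC.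
rewrite -(subrK (\sum_(n < N) v n) (\sum_(i < H) _)).
apply: le_trans (seminormD _ _) _; apply: lerD => //.
rewrite [\sum_(n < N) v n]exchange_big /= -sumrB.
apply: le_trans (seminorm_sum _ _) _.
have -> : 2 * H%:R ^+ 2 * K = \sum_(i < H) 2 * H%:R * K.
  by rewrite sumr_const_ord; ring.
apply: ler_sum => i _; apply: le_trans (seminorm_shift_sum _ _ uK) _.
by rewrite ler_wpM2r // ler_wpM2l // ler_nat ltnW.
Qed.

(** * Orbit hulls and averages along sequences *)

Context (U : int -> V -> V).
Hypothesis actD : forall h u v, U h (u + v) = U h u + U h v.
Hypothesis actZ : forall h (t : R) u, U h (t *: u) = t *: U h u.
Hypothesis actA : forall h k u, U (h + k) u = U h (U k u).
Hypothesis act0 : forall u, U 0 u = u.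
Hypothesis form_act : forall h u v, B (U h u) (U h v) = B u v.

(* Midpoints, i.e. dyadic convex combinations, suffice for the parallelogram
   argument. *)
Inductive orbit_hull (k : int) (v : V) : V -> Prop :=
| orbit_hull_orbit m : orbit_hull k v (U (k * m) v)
| orbit_hull_mid x y : orbit_hull k v x -> orbit_hull k v y ->
    orbit_hull k v (2^-1 *: (x + y)).

Lemma actB h u v : U h (u - v) = U h u - U h v.
Proof. by rewrite actD -scaleN1r actZ scaleN1r. Qed.

Lemma seminorm_act h v : 'n (U h v) = 'n v.
Proof. by rewrite /seminorm form_act. Qed.

Lemma form_adj h u v : B (U h u) v = B u (U (- h) v).
Proof. by rewrite -(form_act (- h)) -actA addNr act0. Qed.

Lemma orbit_hull_refl k v : orbit_hull k v v.
Proof. by rewrite -{2}(act0 v) -(mulr0 k); constructor. Qed.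

Lemma seminorm_mid u v (t : R) : 'n u <= t -> 'n v <= t ->
  'n (2^-1 *: (u + v)) <= t.
Proof.
move=> ut vt; rewrite seminormZ gtr0_norm ?invr_gt0 //.
have := seminormD u v; lra.
Qed.

Lemma orbit_hull_seminorm k v x : orbit_hull k v x -> 'n x <= 'n v.
Proof.
by elim=> [m|y z _ yv _ zv]; [rewrite seminorm_act | exact: seminorm_mid].
Qed.

Lemma orbit_hull_act k v m x : orbit_hull k v x -> orbit_hull k v (U (k * m) x).
Proof.
elim=> [m'|y z _ yP _ zP]; last by rewrite actZ actD; constructor.
by rewrite -actA -mulrDr; constructor.
Qed.

Lemma orbit_hull_dvd k l v x :
  (k %| l)%Z -> orbit_hull l v x -> orbit_hull k v x.
Proof.
case/dvdzP=> q ->; elim=> [m|y z _ yP _ zP]; last by constructor.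
by rewrite mulrAC mulrC; constructor.
Qed.

(** A shift by a m only reindexes the progression, at a cost independent of N, and midpoints average
    the costs. *)
Lemma orbit_hull_sum a b w x : orbit_hull a w x ->
  exists C : R, forall N : nat,
    'n (\sum_(n < N) U (a * n%:Z + b) w - \sum_(n < N) U (a * n%:Z + b) x) <= C.
Proof.
elim=> [m|y z _ [C1 C1P] _ [C2 C2P]].
  have shift (c : int) (i N : nat) :
      'n (\sum_(n < N) U (a * n%:Z + c) w - \sum_(n < N) U (a * (n + i)%N%:Z + c) w)
        <= 2 * i%:R * 'n w.
    by apply: (seminorm_shift_sum (u := fun n => U (a * n%:Z + c) w)) => n; rewrite seminorm_act.
  exists (2 * `|m|%N%:R * 'n w) => N; case: m => i.
    apply: le_trans (shift b i N); rewrite le_eqVlt; apply/orP; left; apply/eqP.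
    congr ('n (_ - _)); apply: eq_bigr => n _; rewrite -actA; congr U.
    by rewrite PoszD; ring.
  (* For m = -(i + 1) the two sums exchange roles and the shift starts from the offset b - a (i +
     1). *)
  rewrite seminormB NegzE abszN.
  apply: le_trans (shift (b - a * i.+1%:Z) i.+1 N).
  rewrite le_eqVlt; apply/orP; left; apply/eqP.
  congr ('n (_ - _)); apply: eq_bigr => n _; rewrite -?actA; congr U.
    by ring.
  by rewrite PoszD; ring.
exists ((C1 + C2) / 2) => N.
have -> : \sum_(n < N) U (a * n%:Z + b) w
    - \sum_(n < N) U (a * n%:Z + b) (2^-1 *: (y + z))
  = 2^-1 *: ((\sum_(n < N) U (a * n%:Z + b) w - \sum_(n < N) U (a * n%:Z + b) y)
     + (\sum_(n < N) U (a * n%:Z + b) w - \sum_(n < N) U (a * n%:Z + b) z)).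
  under [X in _ - X = _]eq_bigr do rewrite actZ actD.
  rewrite -scaler_sumr big_split /= addrACA -opprD scalerBr; congr (_ - _).
  by rewrite -mulr2n -[X in _ = _ *: X]scaler_nat scalerA mulVf ?scale1r // pnatr_eq0.
rewrite seminormZ gtr0_norm ?invr_gt0 //.
have := seminormD (\sum_(n < N) U (a * n%:Z + b) w - \sum_(n < N) U (a * n%:Z + b) y)
   (\sum_(n < N) U (a * n%:Z + b) w - \sum_(n < N) U (a * n%:Z + b) z).
have := C1P N; have := C2P N; lra.
Qed.

(* Van der Corput induction: in degree 0 (an affine [s]) a vector with a small
   element in its orbit hull has small averages, and each correlation of the
   averaged sequence is an average along a sequence of smaller degree. *)
Lemma difference_average_small (d : nat) (beta : R) : 0 < beta ->
  exists2 eta : R, 0 < eta & forall w, 'n w <= 2 ->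
    (forall a : int, a != 0 -> exists2 x, orbit_hull a w x & 'n x <= eta) ->
    forall s, difference_degree d s ->
    \forall N \near \oo, 'n (\sum_(n < N) U (s n) w) <= beta * N%:R.
Proof.
elim: d beta => [|d IH] beta beta_gt0.
  exists (beta / 2) => [|w w2 wP s [a [b [a_neq0 sE]]]]; first by rewrite divr_gt0.
  have [x xw x_small] := wP a a_neq0.
  have [C CP] := orbit_hull_sum b xw.
  near=> N.
  have -> : \sum_(n < N) U (s n) w = \sum_(n < N) U (a * n%:Z + b) w.
    by apply: eq_bigr => n _; rewrite sE.
  rewrite -(subrK (\sum_(n < N) U (a * n%:Z + b) x) (\sum_(n < N) _)).
  apply: le_trans (seminormD _ _) _.
  have xN : 'n (\sum_(n < N) U (a * n%:Z + b) x) <= beta / 2 * N%:R.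
    apply: le_trans (seminorm_sum _ _) _.
    under eq_bigr do rewrite seminorm_act.
    by rewrite sumr_const_ord mulrC ler_wpM2r.
  have CN : C <= beta / 2 * N%:R.
    rewrite mulrC -ler_pdivrMr ?divr_gt0 //; near: N; exact: nbhs_infty_ger.
  have := CP N; lra.
have [|eta eta_gt0 etaP] := IH (beta ^+ 2 / 16).
  by rewrite divr_gt0 ?exprn_gt0.
exists eta => // w w2 wP s sP.
(* This makes 4 + H beta^2 / 8 at most H beta^2 / 4: the H diagonal correlations, each at most 4 N,
   are absorbed. *)
pose H := (Num.trunc (32 / beta ^+ 2)).+1.
have H_large : 32 <= H%:R * beta ^+ 2.
  by rewrite -ler_pdivrMr ?exprn_gt0 // ltW // truncnS_gt.
(* The pairs are finite in number, so one threshold for N serves them all. *)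
have corr : \forall N \near \oo, forall ij : 'I_H * 'I_H, ij.1 != ij.2 ->
    'n (\sum_(n < N) U (s (n + ij.1)%N - s (n + ij.2)%N) w) <= beta ^+ 2 / 16 * N%:R.
  apply: filter_forall => -[i j] /=.
  have [->|ij] := eqVneq i j; first by near=> N.
  have := etaP w w2 wP _ (sP i j ij); apply: filterS => N + _; exact.
near=> N.
have H_gt0 : 0 < H%:R :> R by [].
rewrite -(ler_pM2r H_gt0).
have Y_ge0 : 0 <= H%:R * N%:R * beta / 2 by rewrite !(mulr_ge0, divr_ge0) // ltW.
have bound (n : nat) : 'n (U (s n) w) <= 2 by rewrite seminorm_act.
apply: le_trans (van_der_corput (H := H) (N := N) bound Y_ge0 _) _; last first.
  (* The end terms 4 H^2 are then at most H N beta / 4. *)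
  have N_large : 16 * H%:R / beta <= N%:R by near: N; exact: nbhs_infty_ger.
  rewrite ler_pdivrMr // in N_large.
  nra.
have pair_le (i j : 'I_H) : \sum_(n < N) B (U (s (n + i)%N) w) (U (s (n + j)%N) w)
   <= (i == j)%:R * (4 * N%:R) + beta ^+ 2 / 8 * N%:R.
  have B4 (n : nat) : B (U (s n) w) (U (s n) w) <= 4.
    by rewrite form_act -sqr_seminorm; have := seminorm_ge0 w; nra.
  have [<-|ij] := eqVneq i j.
    rewrite mul1r -[leLHS]addr0; apply: lerD; last first.
      by rewrite !mulr_ge0 ?invr_ge0 ?exprn_ge0 // ltW.
    apply: le_trans (ler_sum _ (fun (n : 'I_N) _ => B4 (n + i)%N)) _.
    by rewrite sumr_const_ord mulrC.
  rewrite mul0r add0r.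
  (* By isometry the correlation becomes an average along the difference sequence, paired with
     [w]. *)
  have -> : \sum_(n < N) B (U (s (n + i)%N) w) (U (s (n + j)%N) w)
      = B (\sum_(n < N) U (s (n + i)%N - s (n + j)%N) w) w.
    rewrite form_suml; apply: eq_bigr => n _.
    by rewrite -(form_act (- s (n + j)%N)) -!actA addNr act0 addrC.
  apply: le_trans (semi_inner_le _ _) _.
  have cij : 'n (\sum_(n < N) U (s (n + i)%N - s (n + j)%N) w) <= beta ^+ 2 / 16 * N%:R.
    have : forall ij : 'I_H * 'I_H, ij.1 != ij.2 ->
      'n (\sum_(n < N) U (s (n + ij.1)%N - s (n + ij.2)%N) w) <= beta ^+ 2 / 16 * N%:R.
      by near: N.
    by move/(_ (i, j)); apply.
  have -> : beta ^+ 2 / 8 * N%:R = (beta ^+ 2 / 16 * N%:R) * 2 by field.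
  by rewrite ler_pM // seminorm_ge0.
have total : \sum_(i < H) \sum_(j < H) \sum_(n < N)
      B (U (s (n + i)%N) w) (U (s (n + j)%N) w)
    <= H%:R * (4 * N%:R) + H%:R ^+ 2 * (beta ^+ 2 / 8 * N%:R).
  apply: le_trans (ler_sum _ (fun i _ => ler_sum _ (fun j _ => pair_le i j))) _.
  have row (i : 'I_H) : \sum_(j < H) ((i == j)%:R * (4 * N%:R) + beta ^+ 2 / 8 * N%:R)
      = 4 * N%:R + H%:R * (beta ^+ 2 / 8 * N%:R).
    rewrite big_split /= (bigD1 i) //= eqxx mul1r big1 ?addr0; last first.
      by move=> j ji; rewrite eq_sym (negbTE ji) mul0r.
    by rewrite sumr_const_ord.
  under eq_bigr do rewrite row.
  rewrite sumr_const_ord le_eqVlt; apply/orP; left.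
  by apply/eqP; ring.
apply: le_trans (ler_wpM2l (ler0n _ N) total) _.
have N2 : 0 <= N%:R ^+ 2 :> R by rewrite sqr_ge0.
have -> : N%:R * (H%:R * (4 * N%:R) + H%:R ^+ 2 * (beta ^+ 2 / 8 * N%:R))
  = N%:R ^+ 2 * H%:R * (4 + H%:R * beta ^+ 2 / 8) :> R by field.
have -> : (H%:R * N%:R * beta / 2) ^+ 2
  = N%:R ^+ 2 * H%:R * (H%:R * beta ^+ 2 / 4) :> R by field.
by rewrite ler_wpM2l ?mulr_ge0 //; lra.
Unshelve. all: by end_near. Qed.

(** The convex combination that yields [x] from [phi] is applied to [w] instead; it nearly fixes
    [psi]. *)
Lemma orbit_hull_remainder k w phi psi x (t : R) :
  (forall m, 'n (U (k * m) psi - psi) <= t) ->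
  w = phi - psi -> orbit_hull k phi x ->
  exists2 y, orbit_hull k w y & 'n (y - (x - psi)) <= t.
Proof.
move=> psiP wE; elim=> [m|y z _ [y' y'w y't] _ [z' z'w z't]].
  exists (U (k * m) w); first by constructor.
  have -> : U (k * m) w - (U (k * m) phi - psi) = psi - U (k * m) psi.
    by rewrite wE actB opprB addrC addrA subrK.
  by rewrite seminormB.
exists (2^-1 *: (y' + z')); first by constructor.
have -> : 2^-1 *: (y' + z') - (2^-1 *: (y + z) - psi)
   = 2^-1 *: ((y' - (y - psi)) + (z' - (z - psi))).
  rewrite addrACA -opprD addrACA -opprD scalerBr scalerBr.
  by rewrite -mulr2n -(scaler_nat 2 psi) scalerA mulVf ?pnatr_eq0 // scale1r.
exact: seminorm_mid.
Qed.

(** * Energy of orbit hulls and recurrence *)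

Lemma parallelogram u v :
  B (u - v) (u - v) = 2 * B u u + 2 * B v v - 4 * B (2^-1 *: (u + v)) (2^-1 *: (u + v)).
Proof.
by rewrite !(formDl, formDr, formZl, formZr, formNl, formNr) (formC v u); field.
Qed.

(* [orbit_energy k] is the squared norm of the projection of [phi] onto the
   vectors fixed by [U k]; it increases along divisibility, so some [k]
   nearly maximizes it. *)
Definition orbit_energy (phi : V) (k : int) : R :=
  inf [set B x x | x in orbit_hull k phi].

Section OrbitEnergy.
Variable phi : V.
Local Notation energy := (orbit_energy phi).

Lemma orbit_energy_le k x : orbit_hull k phi x -> energy k <= B x x.
Proof. by move=> xk; apply: ge_inf; [exists 0 => _ [y _ <-] | exists x]. Qed.

Lemma orbit_energy_adherent k (e : R) : 0 < e ->
  exists2 x, orbit_hull k phi x & B x x <= energy k + e.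
Proof.
move=> e_gt0; pose E := [set B x x | x in orbit_hull k phi].
have [|_ [x xk <-] xe] := inf_adherent (E := E) e_gt0.
- split; first by exists (B phi phi); exists phi => //; exact: orbit_hull_refl.
  by exists 0 => _ [y _ <-].
- by exists x => //; exact: ltW.
Qed.

Lemma orbit_energy_max (e : R) : 0 < e ->
  exists2 k, k != 0 & forall l, l != 0 -> energy l <= energy k + e.
Proof.
move=> e_gt0; pose E := [set energy k | k in [set k : int | k != 0]].
have supE : has_sup E.
  split; first by exists (energy 1); exists 1.
  exists (B phi phi) => _ [k _ <-].
  by apply: orbit_energy_le; exact: orbit_hull_refl.
have [_ [k k_neq0 <-] kE] := sup_adherent e_gt0 supE.
exists k => // l l_neq0.
have : energy l <= sup E by apply: sup_upper_bound => //; exists l.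
by move/le_trans; apply; rewrite -lerBlDr ltW.
Qed.

(** The midpoint lies in the hull, so its squared norm is at least the energy, and the parallelogram
    law leaves at most 6 e^2. The bound on [y] is weaker to admit near-minimizers of hulls for
    multiples of [k]. *)
Lemma orbit_hull_near k (e : R) x y : 0 <= e ->
  orbit_hull k phi x -> orbit_hull k phi y ->
  B x x <= energy k + e ^+ 2 -> B y y <= energy k + 2 * e ^+ 2 ->
  'n (x - y) <= 3 * e.
Proof.
move=> e_ge0 xk yk xe ye; apply: seminorm_le => //; first by rewrite mulr_ge0.
have := orbit_energy_le (orbit_hull_mid xk yk); rewrite parallelogram.
have := sqr_ge0 e; rewrite exprMn; lra.
Qed.

(* [phi = psi + w], where [psi] is almost fixed by all [U (k * m)] and has
   [B psi phi >= c] up to a small error, while the near-maximality of the energy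
   at [k] makes every orbit hull of [w] contain a small vector. *)
Theorem polynomial_recurrence (c : R) (d : nat) (s : int -> nat -> int) :
  'n phi <= 1 -> 0 < c -> (forall x, orbit_hull 1 phi x -> c <= B x x) ->
  (forall k, k != 0 -> difference_degree d (s k) /\ forall n, (k %| s k n)%Z) ->
  exists k n, k != 0 /\ 0 < B (U (s k n) phi) phi.
Proof.
move=> phi1 c_gt0 cP sP.
have [|eta eta_gt0 etaP] := @difference_average_small d (c / 4).
  by rewrite divr_gt0.
(* Two errors of 3 e must fit into [eta] for the small vectors in the hulls of [w], and into c / 4
   for the correlations with [psi]. *)
pose e := Num.min (eta / 6) (c / 24).
have e_gt0 : 0 < e by rewrite lt_min !divr_gt0.
have e_eta : 6 * e <= eta by rewrite mulrC -ler_pdivlMr // ge_min lexx.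
have e_c : 24 * e <= c by rewrite mulrC -ler_pdivlMr // ge_min lexx orbT.
have e2_gt0 : 0 < e ^+ 2 by rewrite exprn_gt0.
clearbody e.
have [k k_neq0 kP] := orbit_energy_max e2_gt0.
have [psi psik psie] := orbit_energy_adherent k e2_gt0.
have psi_fixed m : 'n (U (k * m) psi - psi) <= 3 * e.
  rewrite seminormB; apply: (orbit_hull_near (ltW e_gt0) psik (orbit_hull_act m psik) psie).
  by rewrite form_act; lra.
have c_psi : c <= B psi psi by apply: cP; apply: orbit_hull_dvd psik; rewrite dvd1z.
(* A shift of [phi] moves by adjunction onto the almost fixed [psi]. At x = psi this compares
   [B psi phi] with [B psi psi]. *)
have hull_psi x : orbit_hull k phi x -> `|B psi x - B psi phi| <= 3 * e.
  elim=> [m|y z _ yP _ zP].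
    rewrite formC form_adj formC -mulrN -formNl -formDl.
    apply: le_trans (semi_inner_abs_le _ _) _.
    by rewrite -[leRHS]mulr1 ler_pM ?seminorm_ge0.
  rewrite formZr formDr; move: yP zP; rewrite !ler_norml; lra.
pose w := phi - psi.
have w2 : 'n w <= 2.
  apply: le_trans (seminormD _ _) _; rewrite seminormN.
  by have := orbit_hull_seminorm psik; lra.
have [sk_deg sk_dvd] := sP k k_neq0.
(* A near-minimizer [y] for the multiple a k is also one for k, hence close to [psi]; the hull of
   [w] has a point close to y - psi. *)
have w_small a : a != 0 -> exists2 x, orbit_hull a w x & 'n x <= eta.
  move=> a_neq0; have [y ya ye] := orbit_energy_adherent (a * k) e2_gt0.
  have yk : orbit_hull k phi y by apply: orbit_hull_dvd ya; rewrite dvdz_mull.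
  have [|x xw xP] := @orbit_hull_remainder (a * k) w phi psi y (3 * e) _ erefl ya.
    by move=> m; rewrite (mulrC a) -mulrA.
  exists x; first by apply: orbit_hull_dvd xw; rewrite dvdz_mulr.
  rewrite -(subrK (y - psi) x); apply: le_trans (seminormD _ _) _.
  have := kP (a * k); rewrite mulf_neq0 // => /(_ isT) ak.
  have := orbit_hull_near (ltW e_gt0) psik yk psie; rewrite seminormB.
  have ye2 : B y y <= energy k + 2 * e ^+ 2 by lra.
  by move=> /(_ ye2); lra.
have [N [N_gt0 NP]] : exists N : nat, (0 < N)%N /\
    'n (\sum_(n < N) U (s k n) w) <= c / 4 * N%:R.
  have [N0 _ N0P] := etaP w w2 w_small _ sk_deg.
  by exists N0.+1; split => //; apply: N0P; rewrite /= leqnSn.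
exists k; apply: contrapT => /forallNP noret.
have {}noret n : B (U (s k n) phi) phi <= 0.
  by rewrite leNgt; apply/negP => pos; apply: (noret n).
have main (n : 'I_N) : c / 2 <= B (U (s k n) psi) phi.
  have /dvdzP[q qE] := sk_dvd n.
  have := psi_fixed q; rewrite mulrC -qE => psi_q.
  have : `|B (U (s k n) psi - psi) phi| <= 3 * e.
    apply: le_trans (semi_inner_abs_le _ _) _.
    by rewrite -[leRHS]mulr1 ler_pM ?seminorm_ge0.
  have := hull_psi _ psik; rewrite formDl formNl !ler_norml; lra.
have : \sum_(n < N) B (U (s k n) phi) phi <= 0 by apply: sumr_le0.
have -> : \sum_(n < N) B (U (s k n) phi) phi =
   \sum_(n < N) B (U (s k n) psi) phi + B (\sum_(n < N) U (s k n) w) phi.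
  rewrite form_suml -big_split; apply: eq_bigr => n _.
  by rewrite /= -formDl -actD /w addrC subrK.
have : N%:R * (c / 2) <= \sum_(n < N) B (U (s k n) psi) phi.
  by rewrite -sumr_const_ord; apply: ler_sum.
have : `|B (\sum_(n < N) U (s k n) w) phi| <= c / 4 * N%:R.
  apply: le_trans (semi_inner_abs_le _ _) _.
  by rewrite -[leRHS]mulr1 ler_pM ?seminorm_ge0.
have : 0 < N%:R :> R by rewrite ltr0n.
rewrite ler_norml; nra.
Qed.

End OrbitEnergy.
End SemiInnerProduct.

(** For distinct i and j, f(n + i) - f(n + j) is a polynomial in n of degree exactly one less; [g]
    is read off from the Taylor expansions at n. *)
Lemma difference_degree_poly (d : nat) (f : {poly int}) :
  size f = d.+2 -> difference_degree d (fun n => f.[n%:Z]).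
Proof.
elim: d f => [|d IH] f fs /=.
  exists f`_1, f`_0; split; last first.
    by move=> n; rewrite horner_coef fs !big_ord_recl big_ord0 /= expr0 expr1; ring.
  by have := lead_coef_eq0 f; rewrite lead_coefE fs => ->; rewrite -size_poly_eq0 fs.
move=> i j ij.
pose g := \sum_(t < size f) (i%:Z ^+ t - j%:Z ^+ t) *: f^`N(t).
have gE (n : nat) : g.[n%:Z] = f.[(n + i)%N%:Z] - f.[(n + j)%N%:Z].
  rewrite !PoszD !nderiv_taylor ?/GRing.comm; try exact: mulrC.
  rewrite -sumrB horner_sum; apply: eq_bigr => t _.
  by rewrite hornerZ; ring.
have coefg t : g`_t = \sum_(r < size f) (i%:Z ^+ r - j%:Z ^+ r) * (f`_(r + t) *+ 'C(r + t, r)).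
  by rewrite coef_sum; apply: eq_bigr => r _; rewrite coefZ coef_nderivn.
(* The top coefficient comes from r = 1 alone and is (i - j)(d + 2) times the leading coefficient of
   [f]. *)
have gs : size g = d.+2.
  apply/eqP; rewrite eqn_leq; apply/andP; split.
    apply/leq_sizeP => t dt; rewrite coefg big1 // => -[[|r] r_lt] _ /=.
      by rewrite !expr0 subrr mul0r.
    by rewrite nth_default ?mul0rn ?mulr0 // fs addSn ltnS (leq_trans dt) ?leq_addl.
  rewrite ltnNge; apply/negP => /leq_sizeP/(_ _ (leqnn _)); rewrite coefg fs.
  rewrite big_ord_recl big_ord_recl big1 => [|r _]; last first.
    by rewrite nth_default ?mul0rn ?mulr0 // fs /= /bump /=; lia.
  rewrite /= /bump /= !expr0 subrr mul0r add0r addr0 expr1 expr1 => /eqP.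
  rewrite mulf_eq0 subr_eq0 eqz_nat (negbTE ij) mulrn_eq0 /= add1n bin1 /=.
  by have := lead_coef_eq0 f; rewrite lead_coefE fs /= => ->; rewrite -size_poly_eq0 fs.
have -> : (fun n : nat => f.[(n + i)%N%:Z] - f.[(n + j)%N%:Z]) = (fun n => g.[n%:Z]).
  by apply/funext => n; rewrite gE.
exact: IH.
Qed.

(** * Shift-invariant means of bounded functions *)

Definition bounded_map (R : realType) (T : Type) (u : T -> R) : Prop :=
  exists C : R, forall x, `|u x| <= C.

Section UltraLimit.
Context (R : realType) (G : set_system nat).
Hypothesis GU : UltraFilter G.

Definition ultralim (u : nat -> R) : R := lim (u @ G).

(** Compactness gives a cluster point, and an ultrafilter converges to each of its cluster
    points. *)
Lemma ultralim_cvg (u : nat -> R) : bounded_map u -> u @ G --> ultralim u.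
Proof.
move=> [C uC].
suff [p up] : exists p : R, u @ G --> p by apply/cvg_ex; exists p.
have GF : ProperFilter G by exact: ultra_proper.
have [|p [_ pP]] := @segment_compact R (- C) C (u @ G) _.
  by apply: (@filterE _ G) => n; rewrite /= in_itv /= -ler_norml.
exists p => A pA.
have [//|AC] := in_ultra_setVsetC (u @^-1` A) GU.
have : (u @ G) (~` A) by [].
by move=> /pP/(_ pA)[y []].
Qed.

Lemma ultralimD u v : bounded_map u -> bounded_map v ->
  ultralim (fun n => u n + v n) = ultralim u + ultralim v.
Proof.
move=> /ultralim_cvg uL /ultralim_cvg vL.
have GF : ProperFilter G by exact: ultra_proper.
by apply: cvg_lim => //; exact: cvgD.
Qed.

Lemma ultralimZ (t : R) u : bounded_map u ->
  ultralim (fun n => t * u n) = t * ultralim u.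
Proof.
move=> /ultralim_cvg uL; have GF : ProperFilter G by exact: ultra_proper.
by apply: cvg_lim => //; exact: cvgMr.
Qed.

Lemma ultralim_ge (t : R) u : bounded_map u -> G [set n | t <= u n] ->
  t <= ultralim u.
Proof.
move=> uB; have /cvgP uL := ultralim_cvg uB => tu.
have GF : ProperFilter G by exact: ultra_proper.
exact: limr_ge.
Qed.

Lemma ultralim0 u : \oo `<=` G -> u @ \oo --> (0 : R) -> ultralim u = 0.
Proof.
move=> Goo u0; have GF : ProperFilter G by exact: ultra_proper.
by apply: cvg_lim => // A /u0 uA; exact: Goo.
Qed.

End UltraLimit.

(** The tails restricted to [P] form a proper filter, which extends to an ultrafilter. *)
Lemma frequently_ultra (P : set nat) :
  (forall N, exists2 n, (N <= n)%N & P n) ->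
  exists G, [/\ UltraFilter G, \oo `<=` G & G P].
Proof.
move=> Pfreq.
have PF : ProperFilter (within P \oo).
  apply: Build_ProperFilter => -[N _ NP].
  by have [n Nn Pn] := Pfreq N; exact: NP Nn Pn.
have [G [GU sub]] := ultraFilterLemma PF.
exists G; split => //.
  by move=> A ooA; apply: sub; apply: filterS ooA.
by apply: sub; apply: (@filterE _ \oo).
Qed.

Section BoundedFunctions.
Context (R : realType).

(** As a submodule of all functions, it gives [bfun] the module structure on which the semi-inner
    product lives. *)
Definition bounded_functions : {pred int -> R^o} :=
  [pred f : int -> R^o | `[< bounded_map f >]].

Lemma bounded_functionsP (f : int -> R^o) :
  reflect (bounded_map f) (f \in bounded_functions).
Proof. exact: asboolP. Qed.

Lemma bounded_functions_submod : submod_closed bounded_functions.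
Proof.
split=> [|t f g /bounded_functionsP[C fC] /bounded_functionsP[D gD]].
  by apply/bounded_functionsP; exists 0 => x; rewrite normr0.
apply/bounded_functionsP; exists (`|t| * C + D) => x.
apply: le_trans (ler_normD _ _) _; apply: lerD => //.
by rewrite [X in `|X|]/(t * f x) normrM ler_wpM2l.
Qed.

HB.instance Definition _ := GRing.isSubmodClosed.Build R (int -> R^o)
  bounded_functions bounded_functions_submod.

Record bfun := BFun { bfun_val :> int -> R^o; _ : bfun_val \in bounded_functions }.

HB.instance Definition _ := [isSub for bfun_val].
HB.instance Definition _ := [Choice of bfun by <:].
HB.instance Definition _ := [SubChoice_isSubLmodule of bfun by <:].

Lemma bfun_bounded (f : bfun) : bounded_map f.
Proof. by apply/bounded_functionsP; case: f. Qed.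

Lemma bounded_mapM (T : Type) (f g : T -> R) :
  bounded_map f -> bounded_map g -> bounded_map (fun x => f x * g x).
Proof.
move=> [C fC] [D gD]; exists (C * D) => x.
by rewrite normrM ler_pM.
Qed.

Definition translate_fun (h : int) (f : bfun) : int -> R^o := fun x => f (x + h).

Lemma translate_bounded h f : translate_fun h f \in bounded_functions.
Proof.
by have [C fC] := bfun_bounded f; apply/bounded_functionsP; exists C => x; exact: fC.
Qed.

Definition translate (h : int) (f : bfun) : bfun := BFun (translate_bounded h f).

Definition window_average (f : int -> R) (N : nat) : R :=
  (\sum_(i < 2 * N + 1) f (i%:Z - N%:Z)) / (2 * N + 1)%N%:R.

Lemma window_average_le (f : int -> R) (C : R) :
  (forall x, `|f x| <= C) -> forall N, `|window_average f N| <= C.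
Proof.
move=> fC N; rewrite normrM normfV normr_nat ler_pdivrMr; last by rewrite ltr0n addn1.
apply: le_trans (ler_norm_sum _ _ _) _.
rewrite mulr_natr -[in leRHS](card_ord (2 * N + 1)) -sumr_const.
by apply: ler_sum => i _.
Qed.

Lemma window_average_bounded (f : int -> R) :
  bounded_map f -> bounded_map (window_average f).
Proof. by move=> [C fC]; exists C; exact: window_average_le. Qed.

Lemma window_averageD (f g : int -> R) N :
  window_average (fun x => f x + g x) N = window_average f N + window_average g N.
Proof. by rewrite /window_average big_split mulrDl. Qed.

Lemma window_averageZ (t : R) (f : int -> R) N :
  window_average (fun x => t * f x) N = t * window_average f N.
Proof. by rewrite /window_average -mulr_sumr mulrA. Qed.

(** The difference telescopes to two end values, divided by the window length. *)
Lemma window_average_shift (f : int -> R) : bounded_map f ->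
  (fun N => window_average (fun x => f (x + 1)) N - window_average f N) @ \oo
    --> (0 : R).
Proof.
move=> [C fC].
have C_ge0 : 0 <= C by apply: le_trans (fC 0).
apply/cvgrPdist_le => e e_gt0; near=> N.
rewrite sub0r normrN /window_average -mulrBl -sumrB.
rewrite -(big_mkord xpredT (fun i => f (i%:Z - N%:Z + 1) - f (i%:Z - N%:Z))).
rewrite (@telescope_sumr_eq _ 0 (2 * N + 1) (fun i => f (i%:Z - N%:Z))) //; last first.
  by move=> i _; congr (f _ - _); rewrite -addn1 PoszD; ring.
rewrite normrM normfV normr_nat ler_pdivrMr; last by rewrite ltr0n addn1.
apply: le_trans (ler_normB _ _) _; apply: le_trans (lerD (fC _) (fC _)) _.
have : (2 * C) / e <= N%:R by near: N; exact: nbhs_infty_ger.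
rewrite ler_pdivrMr // [_ * e]mulrC => CN.
have -> : C + C = 2 * C by ring.
apply: le_trans CN _; rewrite ler_wpM2l ?(ltW e_gt0) // ler_nat; lia.
Unshelve. all: by end_near. Qed.

Section Mean.
Context (G : set_system nat).
Hypotheses (GU : UltraFilter G) (Goo : \oo `<=` G).

Definition mean (f : int -> R) : R := ultralim G (window_average f).

Lemma meanD f g : bounded_map f -> bounded_map g ->
  mean (fun x => f x + g x) = mean f + mean g.
Proof.
move=> fB gB; rewrite /mean -(ultralimD GU) //; try exact: window_average_bounded.
by congr ultralim; apply/funext => N; exact: window_averageD.
Qed.

Lemma meanZ (t : R) f : bounded_map f -> mean (fun x => t * f x) = t * mean f.
Proof.
move=> fB; rewrite /mean -(ultralimZ GU) //; try exact: window_average_bounded.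
by congr ultralim; apply/funext => N; exact: window_averageZ.
Qed.

Lemma mean_ge0 f : bounded_map f -> (forall x, 0 <= f x) -> 0 <= mean f.
Proof.
move=> fB f_ge0; apply: (ultralim_ge GU); first exact: window_average_bounded.
have GF : ProperFilter G by exact: ultra_proper.
by apply: filterE => N /=; rewrite divr_ge0 // sumr_ge0.
Qed.

Lemma mean_cst (t : R) : mean (fun=> t) = t.
Proof.
have GF : ProperFilter G by exact: ultra_proper.
rewrite /mean /ultralim [window_average _](_ : _ = fun=> t); first exact: lim_cst.
apply/funext => N; rewrite /window_average sumr_const card_ord -[t *+ _]mulr_natr mulfK //.
Qed.

Lemma mean_shift (f : int -> R) h : bounded_map f ->
  mean (fun x => f (x + h)) = mean f.
Proof.
have shift1 (g : int -> R) : bounded_map g -> mean (fun x => g (x + 1)) = mean g.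
  move=> gB; have gB1 : bounded_map (fun x => g (x + 1)).
    by have [C gC] := gB; exists C => x.
  have := ultralim0 GU Goo (window_average_shift gB).
  under eq_fun do rewrite -mulN1r.
  rewrite ultralimD //; last 2 first.
  - exact: window_average_bounded.
  - have [C gC] := window_average_bounded gB.
    by exists C => N; rewrite mulN1r normrN.
  rewrite ultralimZ //; last exact: window_average_bounded.
  by rewrite mulN1r => /eqP; rewrite subr_eq0 => /eqP.
move=> fB.
have fBh k : bounded_map (fun x => f (x + k)) by have [C fC] := fB; exists C => x.
elim/int_ind: h => [|n IH|n IH].
- by congr mean; apply/funext => x; rewrite addr0.
- rewrite -IH -(shift1 (fun x => f (x + n%:Z))) //; congr mean; apply/funext => x.
  by rewrite -addn1 PoszD; congr f; ring.
- rewrite -IH -(shift1 (fun x => f (x - n.+1%:Z))) //; congr mean; apply/funext => x.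
  by rewrite -addn1 PoszD; congr f; ring.
Qed.

Definition mean_product (f g : bfun) : R := mean (fun x => f x * g x).

Lemma bfunM_bounded (f g : bfun) : bounded_map (fun x => f x * g x).
Proof. by apply: bounded_mapM; exact: bfun_bounded. Qed.

Lemma mean_productD f g k :
  mean_product (f + g) k = mean_product f k + mean_product g k.
Proof.
rewrite /mean_product -meanD; try exact: bfunM_bounded.
by congr mean; apply/funext => x; rewrite -mulrDl.
Qed.

Lemma mean_productZ (t : R) f g : mean_product (t *: f) g = t * mean_product f g.
Proof.
rewrite /mean_product -meanZ; last exact: bfunM_bounded.
by congr mean; apply/funext => x; rewrite mulrA.
Qed.

Lemma mean_productC f g : mean_product f g = mean_product g f.
Proof. by congr mean; apply/funext => x; rewrite mulrC. Qed.

Lemma mean_product_ge0 f : 0 <= mean_product f f.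
Proof.
by apply: mean_ge0; [exact: bfunM_bounded | move=> x; rewrite -expr2 sqr_ge0].
Qed.

Lemma translateD h f g : translate h (f + g) = translate h f + translate h g.
Proof. exact: val_inj. Qed.

Lemma translateZ h (t : R) f : translate h (t *: f) = t *: translate h f.
Proof. exact: val_inj. Qed.

Lemma translateA h k f : translate (h + k) f = translate h (translate k f).
Proof.
by apply: val_inj; apply/funext => x; rewrite /= /translate_fun /= addrA.
Qed.

Lemma translate0 f : translate 0 f = f.
Proof. by apply: val_inj; apply/funext => x; rewrite /= /translate_fun addr0. Qed.

Lemma mean_product_translate h f g :
  mean_product (translate h f) (translate h g) = mean_product f g.
Proof. exact: (mean_shift h (bfunM_bounded f g)). Qed.

(** The variance, the mean of the square of f - m, is nonnegative. *)
Lemma sqr_mean_le (f : bfun) : mean f ^+ 2 <= mean_product f f.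
Proof.
have fB := bfun_bounded f; set m := mean f.
have lB : bounded_map (fun x => (- 2 * m) * f x).
  by have [C fC] := fB; exists (`|- 2 * m| * C) => x; rewrite normrM ler_wpM2l.
have cB : bounded_map (fun _ : int => m ^+ 2 : R) by exists `|m ^+ 2|.
have qB := bfunM_bounded f f.
have sB : bounded_map (fun x => f x * f x + (- 2 * m) * f x).
  have [C qC] := qB; have [D lD] := lB; exists (C + D) => x.
  by apply: le_trans (ler_normD _ _) _; exact: lerD.
have : 0 <= mean (fun x => (f x * f x + (- 2 * m) * f x) + m ^+ 2).
  apply: mean_ge0 => [|x].
    have [C sC] := sB; exists (C + `|m ^+ 2|) => x.
    by apply: le_trans (ler_normD _ _) _; rewrite lerD2r.
  have -> : f x * f x + - 2 * m * f x + m ^+ 2 = (f x - m) ^+ 2 by ring.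
  exact: sqr_ge0.
rewrite !meanD // meanZ // mean_cst -/m /mean_product; lra.
Qed.

End Mean.
End BoundedFunctions.

(** * Density and polynomial recurrence *)

Definition window (N : nat) : seq int := [seq i%:Z - N%:Z | i <- iota 0 (2 * N + 1)].

Lemma mem_window N x : (x \in window N) = (- N%:Z <= x <= N%:Z).
Proof.
apply/mapP/idP => [[i + ->]|/andP[Nx xN]].
  by rewrite mem_iota => ?; lia.
exists `|(x + N%:Z)%R|%N; first by rewrite mem_iota; lia.
by rewrite gez0_abs ?addrK // -lerBlDr sub0r.
Qed.

Lemma window_uniq N : uniq (window N).
Proof. by rewrite map_inj_uniq ?iota_uniq // => i j /addIr[]. Qed.

Lemma card_window (T : set int) N :
  #|` fset_set (T `&` [set k : int | - N%:Z <= k <= N%:Z])| =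
  size [seq x <- window N | x \in T].
Proof.
rewrite -[RHS](congr1 size (undup_id (filter_uniq _ (window_uniq N)))) -card_fseq.
congr (#|` _|); have -> : T `&` [set k : int | - N%:Z <= k <= N%:Z]
    = [set` [fset x in [seq x <- window N | x \in T]]%fset].
  apply/seteqP; split=> x /=; rewrite inE /= mem_filter mem_window.
    by move=> [Tx ->]; rewrite andbT; exact: mem_set.
  by move=> /andP[/set_mem].
by rewrite set_fsetK.
Qed.

Lemma window_average_indic (R : realType) (T : set int) N :
  window_average (\1_T : int -> R) N =
  (#|` fset_set (T `&` [set k : int | - N%:Z <= k <= N%:Z])|)%:R / (2 * N + 1)%N%:R.
Proof.
congr (_ / _); rewrite card_window size_filter -sum1_count natr_sum big_map.
rewrite -(big_mkord xpredT (fun i => \1_T (i%:Z - N%:Z))) /index_iota subn0.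
by rewrite [RHS]big_mkcond /=; apply: eq_bigr => i _; rewrite indicE; case: ifP.
Qed.

Lemma limn_esup_gt0 (R : realType) (u : nat -> R) :
  (0 < limn_esup (fun N => (u N)%:E))%E ->
  exists2 e, 0 < e & forall N, exists2 n, (N <= n)%N & e <= u n.
Proof.
move=> u_gt0; apply: contrapT => /forall2NP small.
move: u_gt0; apply/negP; rewrite -leNgt; apply/lee_addgt0Pr => e e_gt0.
rewrite add0e.
have [//|/existsNP[N NP]] := small e.
apply: (@le_trans _ _ (ereal_sup ((fun n => (u n)%:E) @` [set n | (N <= n)%N]))).
  by apply: ereal_inf_lbound; exists [set n | (N <= n)%N] => //; exists N.
apply: ge_ereal_sup => _ [n /= Nn <-]; rewrite lee_fin leNgt; apply/negP => en.
by apply: NP; exists n => //; exact: ltW.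
Qed.

Lemma limn_esup_ge (R : realType) (u : nat -> R) (e : R) :
  (forall n, e <= u n) -> (e%:E <= limn_esup (fun N => (u N)%:E))%E.
Proof.
move=> ue; apply: le_ereal_inf_tmp => _ [A [N _ NA] <-].
apply: (@le_trans _ _ (u N)%:E); first by rewrite lee_fin.
by apply: ereal_sup_ubound; exists N => //; apply: NA => /=.
Qed.

(** The multiples of m in [0, N] alone give the lower bound 1 / (2 m) in every window. *)
Lemma upper_density_multiples (R : realType) (m : nat) : (0 < m)%N ->
  (0 < upper_density R [set x : int | (m%:Z %| x)%Z])%E.
Proof.
move=> m_gt0; have m2_gt0 : 0 < (2 * m)%N%:R :> R by rewrite ltr0n; lia.
apply: (@lt_le_trans _ _ ((2 * m)%N%:R^-1)%:E); first by rewrite lte_fin invr_gt0.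
apply: limn_esup_ge => N; rewrite card_window.
rewrite ler_pdivlMr; last by rewrite ltr0n addn1.
rewrite ler_pdivrMl // -natrM ler_nat.
apply: (@leq_trans (2 * m * (N %/ m).+1)).
  have := ltn_ceil N m_gt0; nia.
rewrite leq_pmul2l; last by lia.
rewrite -[X in (X <= _)%N](size_iota 0) -(size_map (fun i => (i * m)%N%:Z)).
apply: uniq_leq_size => [|x /mapP[i + ->]].
  rewrite map_inj_uniq ?iota_uniq // => i j [] /eqP.
  by rewrite eqn_pmul2r // => /eqP.
rewrite mem_iota add0n ltnS => /= iN; rewrite mem_filter mem_window.
rewrite mem_set /= ?PoszM ?dvdz_mull //.
have : (i * m <= N)%N by apply: leq_trans (leq_divM N m); rewrite leq_mul2r iN orbT.
lia.
Qed.

(** * The theorem of Kamae and Mendes France *)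

Lemma horner_neq0_near (f : {poly int}) : f != 0 ->
  exists M : nat, forall x : int, M%:Z <= x -> f.[x] != 0.
Proof.
have [n] := ubnP (size f); elim: n f => // n IH f; rewrite ltnS => fn f_neq0.
have [[y fy]|fP] := pselect (exists y, f.[y] = 0); last first.
  by exists 0%N => x _; apply/eqP => fx; apply: fP; exists x.
have /factor_theorem[g fE] : root f y by apply/eqP.
have g_neq0 : g != 0 by apply: contra_neq f_neq0 => g0; rewrite fE g0 mul0r.
have [|M MP] := IH g _ g_neq0.
  by apply: leq_trans fn; rewrite fE size_Mmonic ?monicXsubC // size_XsubC addn2.
(* Beyond the threshold of the cofactor [g] and strictly beyond the root y that was split off. *)
exists (M + `|y|.+1)%N => x xM; rewrite fE hornerM mulf_neq0 //; first
  by apply: MP; apply: le_trans xM; rewrite lez_nat leq_addr.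
rewrite hornerXsubC subr_eq0; apply: contraTneq xM => ->; rewrite -ltNge.
by apply: le_lt_trans (ler_norm y) _; rewrite -abszE ltz_nat ltn_addl.
Qed.

(** Test against T = mZ, whose differences are all multiples of m. *)
Lemma intersective_locally_solvable (R : realType) (f : {poly int}) :
  intersective R f -> locally_solvable f.
Proof.
move=> fI m m_gt0; apply: contrapT => /forallNP fm.
apply: (fI _ (upper_density_multiples R m_gt0)) => _ [[x _ <-] [t1 /= t1m [t2 /= t2m fx]]].
by case: (fm x); rewrite -fx rpredB.
Qed.

Lemma locally_solvable_progression (f : {poly int}) (k : int) :
  f != 0 -> locally_solvable f -> k != 0 ->
  exists2 p : {poly int}, size p = 2%N & forall n : nat,
    f.[p.[n%:Z]] != 0 /\ (k %| f.[p.[n%:Z]])%Z.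
Proof.
move=> f_neq0 fS k_neq0; have [M MP] := horner_neq0_near f_neq0.
have [|x xP] := fS `|k|%N; first by rewrite absz_gt0.
set K := `|k|%N%:Z in xP.
have K_gt0 : 0 < K by rewrite /K; lia.
have kK z : (K %| z)%Z -> (k %| z)%Z by rewrite /K !dvdzE absz_nat.
clearbody K.
(* A progression of roots modulo k; the offset, with K >= 1, starts it at or beyond M even for
   negative x. *)
exists (K *: 'X + (x + K * (M + `|x|)%N%:Z)%:P).
  by rewrite size_polyDl size_scale ?gt_eqF // size_polyX // ltnS size_polyC leq_b1.
move=> n; rewrite hornerD hornerZ hornerX hornerC; split.
  apply: MP.
  have Kn_ge0 : 0 <= K * n%:Z by rewrite mulr_ge0 // ltW.
  have KM_ge : (M + `|x|)%N%:Z <= K * (M + `|x|)%N%:Z by rewrite ler_peMl.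
  lia.
apply: kK; rewrite -(subrK f.[x] f.[_]) rpredD //; apply: dvdz_trans (dvdz_horner_sub _ _ _).
have -> : K * n%:Z + (x + K * (M + `|x|)%N%:Z) - x = K * (n%:Z + (M + `|x|)%N%:Z) by ring.
exact: dvdz_mulr.
Qed.

Lemma locally_solvable_intersective (R : realType) (f : {poly int}) :
  f != 0 -> locally_solvable f -> intersective R f.
Proof.
move=> f_neq0 fS T T_gt0 Tsub.
have [d fd] : exists d, size f = d.+2.
  case fs : (size f) => [|[|d]]; last by exists d.
    by move/eqP: fs; rewrite size_poly_eq0 (negbTE f_neq0).
  have /eqP/size_poly1P[c c_neq0 fE] := fs.
  (* A nonzero constant c is not divisible by |c| + 1, so [f] is nonconstant. *)
  have [|x] := fS `|c|.+1; first by [].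
  rewrite fE hornerC dvdzE /= => /dvdn_leq; rewrite absz_gt0 c_neq0 => /(_ isT).
  by rewrite ltnn.
have [e e_gt0 eP] := limn_esup_gt0 T_gt0.
have [G [GU Goo GT]] := frequently_ultra eP.
have indicB : (\1_T : int -> R^o) \in @bounded_functions R.
  apply/bounded_functionsP; exists 1 => x; rewrite indicE.
  by case: (_ \in _); rewrite ?normr1 ?normr0.
pose phi := BFun indicB.
have phiB : bounded_map phi by exact: bfun_bounded.
have phi_mean : e <= mean G phi.
  apply: (ultralim_ge GU); first exact: window_average_bounded.
  have GF : ProperFilter G by exact: ultra_proper.
  apply: filterS GT => N /=.
  by rewrite window_average_indic.
(* For nonzero k the default 0 is not taken. As [p k] is linear, its composites with [f] have the
   same degree for all such k. *)
pose p (k : int) : {poly int} := xget 0 [set g : {poly int} |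
    size g = 2%N /\ forall n : nat, f.[g.[n%:Z]] != 0 /\ (k %| f.[g.[n%:Z]])%Z].
have pP k : k != 0 -> size (p k) = 2%N /\ forall n : nat,
    f.[(p k).[n%:Z]] != 0 /\ (k %| f.[(p k).[n%:Z]])%Z.
  move=> k_neq0; have [q q2 qP] := locally_solvable_progression f_neq0 fS k_neq0.
  by rewrite /p; case: xgetP => [r _ //|/(_ q)]; case.
have [|||k k_neq0|k [n [k_neq0 pos]]] := @polynomial_recurrence R (bfun R)
    (mean_product G) (mean_productD GU) (mean_productZ GU) (@mean_productC R G)
    (mean_product_ge0 GU) (@translate R) (@translateD R) (@translateZ R)
    (@translateA R) (@translate0 R) (mean_product_translate GU Goo) phi
    (e ^+ 2) d (fun k n => f.[(p k).[n%:Z]]).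
- apply: (seminorm_le (mean_product_ge0 GU)) => //; rewrite expr1n -subr_ge0.
  have phiphiB := bfunM_bounded phi phi.
  have -> : 1 - mean_product G phi phi = mean G (fun x => 1 + (-1) * (phi x * phi x)).
    rewrite meanD // ?meanZ ?mean_cst ?mulN1r //; first by exists 1 => _; rewrite normr1.
    by have [C phiC] := phiphiB; exists C => x; rewrite mulN1r normrN.
  have [C phiC] := phiphiB; apply: mean_ge0 => //.
    exists (1 + C) => x; apply: le_trans (ler_normD _ _) _.
    by rewrite normr1 mulN1r normrN lerD2l.
  move=> x /=; by rewrite indicE; case: (_ \in _); rewrite !(mulr0, mulr1, addr0, subrr).
- by rewrite exprn_gt0.
(* The mean is constant on the hull by shift invariance, and it is at least e at [phi]. *)
- move=> x xphi; apply: le_trans (sqr_mean_le GU x).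
  suff -> : mean G x = mean G phi by rewrite ler_pXn2r // nnegrE ltW // (lt_le_trans e_gt0).
  elim: xphi => [m|y z _ yP _ zP]; first exact: (mean_shift GU Goo).
  have yB := bfun_bounded y; have zB := bfun_bounded z.
  have yzB : bounded_map (fun t => y t + z t) by exact: (bfun_bounded (y + z)).
  have -> : mean G (2^-1 *: (y + z)) = 2^-1 * (mean G y + mean G z).
    by rewrite -meanD // -meanZ.
  by rewrite yP zP; field.
- have [pk2 pkP] := pP k k_neq0; split; last by move=> n; have [] := pkP n.
  have -> : (fun n : nat => f.[(p k).[n%:Z]]) = (fun n : nat => (f \Po p k).[n%:Z]).
    by apply/funext => n; rewrite horner_comp.
  by apply: difference_degree_poly; rewrite size_comp_poly2.
have [_ /(_ n)[fn_neq0 _]] := pP k k_neq0.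
(* Otherwise the product of the two indicators vanishes identically and its mean is not positive. *)
have [t [Tth Tt]] : exists t, T (t + f.[(p k).[n%:Z]]) /\ T t.
  apply: contrapT => /forallNP noT; move: pos.
  rewrite /mean_product (_ : (fun x => _) = fun=> 0) ?mean_cst ?ltxx //.
  apply/funext => x /=; rewrite /translate_fun /= !indicE.
  case: (boolP (_ \in T)) => [/set_mem Txh|]; last by rewrite mul0r.
  case: (boolP (x \in T)) => [/set_mem Tx|]; last by rewrite mulr0.
  by case: (noT x).
have /eqP := fn_neq0; apply; apply: Tsub; split; first by exists (p k).[n%:Z].
exists (t + f.[(p k).[n%:Z]]) => //; exists t => //.
by rewrite addrAC subrr add0r.
Qed.

Lemma kamae_mendes_france (R : realType) (f : {poly int}) : f != 0 ->
  intersective R f <-> locally_solvable f.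
Proof.
by split; [exact: intersective_locally_solvable | exact: locally_solvable_intersective].
Qed.

Theorem corollary2 (R : realType) (q : nat) (hq : prime q) (hodd : odd q)
    (l : nat) (a : 'I_l -> int) (c : 'I_l -> 'F_q)
    (ha : forall j, a j != 1 /\ a j != -1)
    (hfree : forall j, qfree q (a j))
    (hc : forall j, c j != 0) :
  intersective R (\prod_(j < l) ('X^q - (a j)%:P))
  <->
  intersective R (\prod_(j < l) ('X^q - (radq q (a j ^+ c j))%:P)).
Proof.
have q_gt0 := prime_gt0 hq.
have prod_neq0 (b : 'I_l -> int) : \prod_(j < l) ('X^q - (b j)%:P) != 0.
  by apply/monic_neq0/monic_prod => j _; exact: monicXnsubC.
rewrite !kamae_mendes_france //.
(* Zero is divisible by 2^q, hence not q-free. *)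
have a_neq0 j : a j != 0.
  by apply: contraTneq (hfree j 2%N isT) => ->; rewrite dvdz0.
have c_gt0 j : (0 < c j)%N by rewrite lt0n; exact: hc.
apply: locally_solvable_radq => // j.
(* The representative of [c j] lies strictly between 0 and q. *)
rewrite prime_coprime // gtnNdvd //.
by apply: leq_trans (ltn_ord (c j)) _; rewrite Fp_cast.
Qed.
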